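(* Let $\mu$ be a joint distribution of $(X,A,Y)$ with $X\in\mathcal{X}\subseteq\mathbb{R}^d$, $A\in\{0,1\}$, $Y\in\{0,1\}$, and let $h_0^*,h_1^*:\mathcal{X}\to\{0,1\}$ be the Bayes optimal classifiers on the groups $A=0$ and $A=1$. Assume that $Y=h_0^*(X)$ almost surely under $\mu_0$ and $Y=h_1^*(X)$ almost surely under $\mu_1$. Then the randomized classifier $h^*_{\mathrm{Fair}}$ (constructed from $h_0^*,h_1^*$ and the base rates as described in the context) satisfies demographic parity, i.e. $\widehat{Y}=h^*_{\mathrm{Fair}}(X,A)$ is independent of $A$, and it is optimal in the sense that $$\mathrm{Err}_{\mu_0}(h^*_{\mathrm{Fair}})+\mathrm{Err}_{\mu_1}(h^*_{\mathrm{Fair}})=\Delta_{\mathrm{BR}}(\mu_0,\mu_1).$$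
   Context: For $a\in\{0,1\}$, $\mu_a$ is the conditional distribution of $\mu$ given $A=a$ (it is assumed $\Pr(A=a)>0$). $\Delta_{\mathrm{BR}}(\mu_0,\mu_1)=|\mu_0(Y=1)-\mu_1(Y=1)|$. The Bayes optimal classifier on group $a$ is $h_a^*(x)=1$ if $\mathbb{E}[Y\mid X=x,A=a]\ge 1/2$ and $h_a^*(x)=0$ otherwise. Construction of $h^*_{\mathrm{Fair}}$: let $\alpha=\Pr_{\mu_0}(Y=1)$ and $\beta=\Pr_{\mu_1}(Y=1)$, and (without loss of generality, by naming the groups) $\alpha\ge\beta$; if $\alpha<\beta$ the roles of the two groups are interchanged. Let $S\sim U(0,1)$ be uniform on $(0,1)$, independent of $(X,A,Y)$. On input $(x,a)$, with $s$ the realization of $S$: - if $a=0$: $h^*_{\mathrm{Fair}}(x,0)=1$ if $h_0^*(x)=1$ and $s\le\frac{\alpha+\beta}{2\alpha}$; otherwise $h^*_{\mathrm{Fair}}(x,0)=0$. - if $a=1$: $h^*_{\mathrm{Fair}}(x,1)=1$ if $h_1^*(x)=1$, or if $h_1^*(x)=0$ and $s\le\frac{\alpha-\beta}{2(1-\beta)}$; otherwise $h^*_{\mathrm{Fair}}(x,1)=0$. In the degenerate cases $\alpha=0$ or $\beta=1$ the threshold with zero denominator may be taken to be any number in $[0,1]$. For a randomized classifier $h$, $\mathrm{Err}_{\mu_a}(h)=\Pr(Y\neq h(X,A)\mid A=a)$, the probability being over both the data and the internal randomness $S$. *)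

(* Defs.v *)
From HB Require Import structures.
From mathcomp Require Import all_boot all_order all_algebra.
From mathcomp Require Import all_classical all_reals all_analysis.

Set Implicit Arguments.
Unset Strict Implicit.
Unset Printing Implicit Defensive.

Import Order.TTheory GRing.Theory Num.Theory.

Local Open Scope classical_set_scope.
Local Open Scope ring_scope.

(* A sample ((x, a), y) consists of the features x, the group a and the label
   y; the values 0 and 1 of the group and of the label are false and true. *)
Section sample.
Context {d} {T : measurableType d}.

Definition feature (z : T * bool * bool) : T := z.1.1.
Definition group (z : T * bool * bool) : bool := z.1.2.
Definition label (z : T * bool * bool) : bool := z.2.

Lemma measurable_feature : measurable_fun setT feature.
Proof. exact: measurableT_comp measurable_fst measurable_fst. Qed.

Lemma measurable_group : measurable_fun setT group.
Proof. exact: measurableT_comp measurable_snd measurable_fst. Qed.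

Lemma measurable_label : measurable_fun setT label.
Proof. exact: measurable_snd. Qed.

HB.instance Definition _ := isMeasurableFun.Build _ _ _ _ feature
  measurable_feature.
HB.instance Definition _ := isMeasurableFun.Build _ _ _ _ group
  measurable_group.
HB.instance Definition _ := isMeasurableFun.Build _ _ _ _ label
  measurable_label.

End sample.

Section conditioning.
Context {d} {T : measurableType d} {R : realType}.

Lemma measurable_fiber (A : {mfun T >-> bool}) (a : bool) :
  measurable (A @^-1` [set a]).
Proof. by rewrite -[X in measurable X]setTI; exact: measurable_funP. Qed.

(* P( . | A = a); mnormalize returns its second argument P only when
   P(A = a) = 0. *)
Definition cond_prob (P : probability T R) (A : {mfun T >-> bool}) (a : bool)
    : probability T R :=
  mnormalize (mrestr P (measurable_fiber A a)) P.

(* eta is a version of the regression function x |-> E[V | X = x]. *)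
Definition is_regression_function {d'} {T' : measurableType d'}
    (P : probability T R) (V : T -> R) (X : T -> T') (eta : T' -> R) : Prop :=
  [/\ measurable_fun setT eta,
      P.-integrable setT (fun w => (eta (X w))%:E) &
      forall B : set T', measurable B ->
        (\int[P]_(w in X @^-1` B) (eta (X w))%:E =
         \int[P]_(w in X @^-1` B) (V w)%:E)%E].

Definition independent_rv {d1 d2} {T1 : measurableType d1}
    {T2 : measurableType d2} (P : probability T R) (U : T -> T1) (V : T -> T2)
    : Prop :=
  [/\ measurable_fun setT U, measurable_fun setT V &
      forall (E : set T1) (F : set T2), measurable E -> measurable F ->
        P (U @^-1` E `&` V @^-1` F) = (P (U @^-1` E) * P (V @^-1` F))%E].

(* The equality is only required on measurable sets: the values of a measure
   elsewhere are meaningless. *)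
Definition has_law {d'} {T' : measurableType d'} (P : probability T R)
    (U : T -> T') (nu : set T' -> \bar R) : Prop :=
  measurable_fun setT U /\
  forall E : set T', measurable E -> P (U @^-1` E) = nu E.

End conditioning.

Section fairness.
Context {d} {T : measurableType d} {R : realType}.
Implicit Types (mu nu : probability (T * bool * bool)%type R).

Definition group_law mu (a : bool) : probability (T * bool * bool)%type R :=
  cond_prob mu group a.

Definition base_rate nu : R := fine (nu [set z | label z = true]).

Definition Delta_BR nu0 nu1 : R := `|base_rate nu0 - base_rate nu1|.

(* Conditional expectations are only determined up to null sets: h is the
   Bayes classifier attached to some version of E[Y | X = x]. Classifiers are
   functions on calX, so their values outside of calX are irrelevant. *)
Definition is_bayes_classifier (calX : set T) nu (h : T -> bool) : Prop :=
  exists2 eta : T -> R,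
    is_regression_function nu (fun z => (label z)%:R) feature eta &
    forall x, calX x -> h x = (2^-1 <= eta x).

(* t = num / den, or any number in [0, 1] when den = 0. *)
Definition is_threshold (num den t : R) : Prop :=
  (den != 0 -> t = num / den) /\ (den = 0 -> 0 <= t <= 1).

(* The group playing the part of "a = 0" in the construction, i.e. the one
   with the larger base rate (group 0 in case of a tie). *)
Definition top_group mu : bool :=
  if base_rate (group_law mu true) <= base_rate (group_law mu false)
  then false else true.

(* t_top and t_bot are the thresholds for the group top and for the other group; s
   is the realization of the internal randomness. *)
Definition h_fair (h : bool -> T -> bool) (top : bool) (t_top t_bot : R)
    (x : T) (a : bool) (s : R) : bool :=
  if a == top then h a x && (s <= t_top)
  else h a x || (~~ h a x && (s <= t_bot)).

End fairness.

Section randomized.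
Context {d} {Omega : measurableType d} {R : realType}.

Definition demographic_parity (P : probability Omega R) (A Yhat : Omega -> bool)
    : Prop :=
  independent_rv P Yhat A.

(* Err_{mu_a}: P also governs the internal randomness of Yhat. *)
Definition Err (P : probability Omega R) (A : {mfun Omega >-> bool})
    (Y Yhat : Omega -> bool) (a : bool) : R :=
  fine (cond_prob P A a [set w | Y w <> Yhat w]).

End randomized.

(* Main.v *)
(* Given A = a, the randomness S keeps its uniform law and stays independent of
   Y, and Y = h_a(X) almost surely. So, on the group with the larger base rate
   alpha, h_fair thins the event Y = 1 by the factor t_top, and on the other
   group it thins the event Y = 0 by the factor 1 - t_bot. With the chosen
   thresholds both groups are accepted with probability (alpha + beta) / 2, and
   each of them contributes (alpha - beta) / 2 to the error. *)
Require Import Defs.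
From HB Require Import structures.
From mathcomp Require Import all_boot all_order all_algebra.
From mathcomp Require Import all_classical all_reals all_analysis.
From mathcomp Require Import measurable_realfun ring lra.

Set Implicit Arguments.
Unset Strict Implicit.
Unset Printing Implicit Defensive.

Import Order.TTheory GRing.Theory Num.Theory.

Local Open Scope classical_set_scope.
Local Open Scope ring_scope.

(** * Events and independence for Boolean random variables *)

Section events.
Context {d} {T : measurableType d} {R : realType}.
Implicit Types (P : probability T R) (E F C : set T) (U V : T -> bool).

Lemma measurable_bool_fiber U (b : bool) :
  measurable_fun setT U -> measurable [set w | U w = b].
Proof.
move=> mU; rewrite (_ : [set w | _] = U @^-1` [set b])//.
by rewrite -[X in measurable X]setTI; exact: mU.
Qed.

Lemma fine_probK P E : measurable E -> (fine (P E))%:E = P E.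
Proof. by move=> mE; rewrite fineK// fin_num_measure. Qed.

(** Removing the exceptional null set [N] changes neither measure, and off [N] the two events
    coincide. This is how the almost sure identity between label and classifier enters the
    computation of probabilities. *)
Lemma eq_measure_ae P E F : measurable E -> measurable F ->
  {ae P, forall w, E w <-> F w} -> P E = P F.
Proof.
move=> mE mF [N [mN PN0 EFN]].
have EF w : ~ N w -> E w <-> F w by move=> Nw; apply: contrapT => /EFN.
have off G : measurable G -> P G = P (G `\` N).
  move=> mG; rewrite (measureDI P mG mN).
  rewrite [X in (_ + X)%E](_ : _ = 0%E) ?adde0//.
  apply/eqP; rewrite -measure_le0 -PN0 le_measure ?inE//.
  exact: measurableI.
rewrite (off E)// (off F)//; congr (P _).
by apply/seteqP; split => w [? Nw]; split => //; apply/EF.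
Qed.

(** [bool] has only four subsets: the case of [[set false]] follows by complementation inside [C],
    and the empty and full sets are trivial. *)
Lemma indep_event_bool P U C :
  measurable_fun setT U -> measurable C ->
  P (U @^-1` [set true] `&` C) = (P (U @^-1` [set true]) * P C)%E ->
  forall E : set bool, P (U @^-1` E `&` C) = (P (U @^-1` E) * P C)%E.
Proof.
move=> mU mC PUC E.
have mt : measurable (U @^-1` [set true]) by exact: measurable_bool_fiber.
case: (set_bool E) => /eqP -> //.
- have -> : U @^-1` [set false] = ~` (U @^-1` [set true]).
    by apply/seteqP; split => w /=; case: (U w).
  have PD : P (C `\` U @^-1` [set true]) =
      (P C - P (U @^-1` [set true] `&` C))%E.
    by rewrite measureD// ?ltey_eq ?fin_num_measure// setIC.
  rewrite probability_setC// setIC -setDE PD PUC.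
  rewrite -(fine_probK P mt) -(fine_probK P mC).
  by rewrite -EFinM -!EFinB -EFinM; congr (_%:E); ring.
- by rewrite preimage_set0 set0I measure0 mul0e.
- by rewrite preimage_setT setTI probability_setT mul1e.
Qed.

(** Here [q] is a common conditional probability of [U = true] given [V = b], written without
    division. Summing over [b] identifies [q] with the probability of [U = true], so the hypothesis
    becomes the product formula on singletons; it then extends to all events of [V], and next to all
    events of [U]. *)
Lemma independent_rv_bool P U V (q : \bar R) :
  measurable_fun setT U -> measurable_fun setT V ->
  (forall b, P (U @^-1` [set true] `&` V @^-1` [set b]) =
             q * P (V @^-1` [set b]))%E ->
  independent_rv P U V.
Proof.
move=> mU mV PUV.
have mt (W : T -> bool) (b : bool) : measurable_fun setT W -> measurable (W @^-1` [set b]).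
  by move=> mW; exact: measurable_bool_fiber.
have split_V E : measurable E ->
    P E = (P (E `&` V @^-1` [set true]) + P (E `&` V @^-1` [set false]))%E.
  move=> mE; rewrite -measureU; first last.
  - by apply/seteqP; split => w //= -[[_ ->] []].
  - by apply: measurableI => //; exact: mt.
  - by apply: measurableI => //; exact: mt.
  congr (P _); apply/seteqP; split => w /= => [Ew|[[]|[]]//].
  by case: (V w); [left|right].
have PU : P (U @^-1` [set true]) = q.
  rewrite (split_V _ (mt U true mU)) !PUV -ge0_muleDr//.
  have := split_V setT measurableT; rewrite !setTI => <-.
  by rewrite probability_setT mule1.
split=> // E F _ _.
have mVF : measurable (V @^-1` F) by rewrite -[X in measurable X]setTI; exact: mV.
apply: indep_event_bool => //.
rewrite setIC muleC; apply: indep_event_bool => //; first exact: mt.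
by rewrite setIC PUV PU muleC.
Qed.

End events.

Lemma uniform_prob01_le (R : realType) (t : R) : 0 <= t <= 1 ->
  uniform_prob (@ltr01 R) [set s | s <= t] = t%:E.
Proof.
move=> /andP[t0 t1]; rewrite /uniform_prob integral_uniform_pdf.
rewrite (_ : _ `&` _ = `[0, t]%classic); last first.
  apply/seteqP; split => s /=; rewrite !in_itv/=.
    by move=> [st /andP[-> _]].
  by move=> /andP[-> st]; split => //=; exact: le_trans t1.
rewrite (eq_integral (cst 1%E)); last first.
  move=> s; rewrite inE/= in_itv/= => /andP[s0 st].
  by rewrite /uniform_pdf s0 (le_trans st t1)/= subr0 invr1.
rewrite integral_cst//= mul1e lebesgue_measure_itv/= lte_fin.
(* The length formula for [[0, t]] distinguishes [0 < t] from the degenerate interval, where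
   [t = 0]. *)
case: ltP => [_|t0']; first by rewrite oppr0 adde0.
by congr EFin; apply/eqP; rewrite eq_le t0 t0'.
Qed.

(** * Conditioning on the value of a Boolean variable *)

Section conditional_law.
Context {d} {T : measurableType d} {R : realType}.
Variables (P : probability T R) (A : {mfun T >-> bool}) (a : bool).
Hypothesis PA : (0 < P (A @^-1` [set a]))%E.

Lemma cond_probE (E : set T) :
  cond_prob P A a E =
  (P (E `&` A @^-1` [set a]) * ((fine (P (A @^-1` [set a])))^-1)%:E)%E.
Proof.
rewrite /cond_prob/= /mnormalize/= /mrestr/= setTI gt_eqF//=.
rewrite ifF//; apply/negbTE; rewrite -ltey ltey_eq.
by rewrite fin_num_measure//; exact: measurable_fiber.
Qed.

Lemma cond_prob_mulE (E : set T) : measurable E ->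
  (cond_prob P A a E * P (A @^-1` [set a]) = P (E `&` A @^-1` [set a]))%E.
Proof.
move=> mE; have mA := measurable_fiber A a.
have PA0 : fine (P (A @^-1` [set a])) != 0.
  by rewrite gt_eqF// -lte_fin fine_probK.
rewrite cond_probE -(fine_probK P mA) -(fine_probK P (measurableI _ _ mE mA)).
by rewrite -!EFinM mulfVK.
Qed.

Lemma ae_cond_prob : {ae cond_prob P A a, forall w, A w = a}.
Proof.
have mA := measurable_fiber A a.
exists (~` (A @^-1` [set a])); split => //; first exact: measurableC.
by rewrite /= cond_probE setICl measure0 mul0e.
Qed.

(** Since [A] is a function of [U], intersecting an event of [U] with [A = a] gives again an event
    of [U], still independent of [V]. So conditioning leaves the law of [V] unchanged. *)
Lemma cond_prob_indep {d1 d2} {T1 : measurableType d1} {T2 : measurableType d2}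
    (U : T -> T1) (V : T -> T2) (B : {mfun T1 >-> bool}) :
  independent_rv P U V -> (forall w, A w = B (U w)) ->
  forall E F, measurable E -> measurable F ->
  cond_prob P A a (U @^-1` E `&` V @^-1` F) =
  (cond_prob P A a (U @^-1` E) * P (V @^-1` F))%E.
Proof.
move=> [mU mV indep] AB E F mE mF.
have AE : A @^-1` [set a] = U @^-1` (B @^-1` [set a]).
  by apply/seteqP; split => w /=; rewrite AB.
rewrite !cond_probE setIAC AE -preimage_setI indep//; last first.
  by apply: measurableI => //; exact: measurable_fiber.
by rewrite muleAC.
Qed.

End conditional_law.

(** Conditioning commutes with taking laws, because [A = a] is the preimage under [U] of [B = a]. It
    carries statements about [group_law mu a] over to [Omega]. *)
Lemma cond_prob_law {d d1} {T : measurableType d} {T1 : measurableType d1}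
    {R : realType} (P : probability T R) (A : {mfun T >-> bool}) (a : bool)
    (U : T -> T1) (B : {mfun T1 >-> bool}) (nu : probability T1 R) :
  has_law P U nu -> (forall w, A w = B (U w)) ->
  (0 < nu (B @^-1` [set a]))%E ->
  forall E, measurable E -> cond_prob nu B a E = cond_prob P A a (U @^-1` E).
Proof.
move=> [mU lawU] AB nuB E mE.
have mB := measurable_fiber B a.
have AE : A @^-1` [set a] = U @^-1` (B @^-1` [set a]).
  by apply/seteqP; split => w /=; rewrite AB.
rewrite !cond_probE// ?AE ?lawU// -preimage_setI lawU//.
exact: measurableI.
Qed.

Theorem theorem14 (R : realType) (d : nat) (calX : set (d.-tuple R))
  (mu : probability (d.-tuple R * bool * bool)%type R)
  (disp : measure_display) (Omega : measurableType disp)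
  (P : probability Omega R)
  (X : {RV P >-> d.-tuple R}) (A Y : {RV P >-> bool}) (S : {RV P >-> R})
  (HX : forall w, calX (X w))
  (Hmu : has_law P (fun w => (X w, A w, Y w)) mu)
  (HS : has_law P S (uniform_prob (@ltr01 R)))
  (HXAY_S : independent_rv P (fun w => (X w, A w, Y w)) S)
  (HA : forall a : bool, (0 < mu (group @^-1` [set a]))%E)
  (h : bool -> d.-tuple R -> bool)
  (Hbayes : forall a, is_bayes_classifier calX (group_law mu a) (h a))
  (HY : forall a, {ae group_law mu a,
     forall z, calX (feature z) -> label z = h a (feature z)})
  (alpha beta t_top t_bot : R)
  (Halpha : alpha = base_rate (group_law mu (top_group mu)))
  (Hbeta : beta = base_rate (group_law mu (~~ top_group mu)))
  (Ht_top : is_threshold (alpha + beta) (2 * alpha) t_top)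
  (Ht_bot : is_threshold (alpha - beta) (2 * (1 - beta)) t_bot) :
  let Yhat := fun w => h_fair h (top_group mu) t_top t_bot (X w) (A w) (S w) in
  demographic_parity P A Yhat /\
  Err P A Y Yhat false + Err P A Y Yhat true =
    Delta_BR (group_law mu false) (group_law mu true).
Proof.
move=> Yhat.
pose U w := (X w, A w, Y w).

(* Transfer to [Omega] and measurability *)
have mA : measurable_fun setT A by exact: measurable_funP.
have mY : measurable_fun setT Y by exact: measurable_funP.
have mS : measurable_fun setT S by exact: measurable_funP.
have [mU lawU] := Hmu.
have PA a : (0 < P ((A : Omega -> bool) @^-1` [set a]))%E.
  by have := HA a; rewrite -lawU//; exact: measurable_fiber.
have QU a E : measurable E ->
    group_law mu a E = cond_prob P A a (U @^-1` E).
  by apply: cond_prob_law => //; exact: HA.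
have mhX a : measurable_fun setT (fun w => h a (X w)).
  have [eta [meta _ _] hE] := Hbayes a.
  (* [h a] is a threshold of a measurable function only on [calX], but [X] takes all its values
     there, so the composite is measurable. *)
  rewrite (_ : (fun w => _) = (fun w => 2^-1 <= eta (X w))); last first.
    by apply/funext => w; exact: hE.
  apply: measurable_fun_ler => //.
  by apply: measurableT_comp => //; exact: measurable_funP.
have mle t : measurable_fun setT (fun w => S w <= t).
  exact: measurable_fun_ler.
have mh_fair a : measurable_fun setT
    (fun w => h_fair h (top_group mu) t_top t_bot (X w) a (S w)).
  rewrite /h_fair; case: (a == _); first exact: measurable_and.
  by apply: measurable_or => //; apply: measurable_and => //;
    exact: measurable_neg.
have mYhat : measurable_fun setT Yhat.
  rewrite (_ : Yhat = fun w => if A w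
      then h_fair h (top_group mu) t_top t_bot (X w) true (S w)
      else h_fair h (top_group mu) t_top t_bot (X w) false (S w)).
    exact: measurable_fun_ifT.
  by apply/funext => w; rewrite /Yhat; case: (A w).
have mErr : measurable [set w | Y w <> Yhat w].
  rewrite (_ : [set w | _] = [set w | (Y w (+) Yhat w) = true]); last first.
    by apply/seteqP; split => w /=; case: (Y w); case: (Yhat w).
  apply: measurable_bool_fiber.
  rewrite (_ : (fun w => _) = fun w => if Y w then ~~ Yhat w else Yhat w).
    by apply: measurable_fun_ifT => //; exact: measurable_neg.
  by apply/funext => w; case: (Y w); case: (Yhat w).

(* Joint law of the label and the randomness given the group *)
have aeY a : {ae cond_prob P A a, forall w, Y w = h a (X w) /\ A w = a}.
  have aeU : {ae cond_prob P A a, forall w, Y w = h a (X w)}.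
    have [N [mN N0 sub]] := HY a.
    exists (U @^-1` N); split.
    - by rewrite -[X in measurable X]setTI; exact: mU.
    - by rewrite -QU.
    - by move=> w /= Yh; apply: sub => /= Yh'; apply: Yh; exact: (Yh' (HX w)).
  by apply: filterS2 aeU (ae_cond_prob (PA a)).
pose base a := base_rate (group_law mu a).
have QY a : cond_prob P A a [set w | Y w = true] = (base a)%:E.
  have ml : measurable [set z : d.-tuple R * bool * bool | label z = true].
    by apply: measurable_bool_fiber; exact: measurable_label.
  by rewrite /base /base_rate fine_probK// QU.
have QYF a : cond_prob P A a [set w | Y w = false] = (1 - base a)%:E.
  rewrite (_ : [set w | _] = ~` [set w | Y w = true]); last first.
    by apply/seteqP; split => w /=; case: (Y w).
  by rewrite probability_setC ?QY//; exact: measurable_bool_fiber.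
have base01 a : 0 <= base a <= 1.
  by rewrite -!lee_fin -QY measure_ge0 probability_le1//; exact: measurable_bool_fiber.
have Sle (t : R) : 0 <= t <= 1 -> P [set w | S w <= t] = t%:E.
  move=> t01; have [_ lawS] := HS; rewrite -(uniform_prob01_le t01) -lawS//.
  by rewrite -[X in measurable X]setTI; exact: measurable_fun_ler.
(* Both [Y] and [A] are components of the triple that is independent of [S], so the second factor is
   the unconditional law of [S]. *)
have QYS a y b t : cond_prob P A a [set w | Y w = y /\ (S w <= t) = b] =
    (cond_prob P A a [set w | Y w = y] * P [set w | (S w <= t)%R = b])%E.
  have mly : measurable [set z : d.-tuple R * bool * bool | label z = y].
    by apply: measurable_bool_fiber; exact: measurable_label.
  have mFb : measurable [set s : R | (s <= t) = b].
    by apply: measurable_bool_fiber; exact: measurable_fun_ler.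
  by have := cond_prob_indep (B := group) (PA a) HXAY_S (fun=> erefl) mly mFb.
have Sgt (t : R) : 0 <= t <= 1 -> P [set w | (S w <= t) = false] = (1 - t)%:E.
  move=> t01; rewrite (_ : [set w | _] = ~` [set w | S w <= t]).
    by rewrite probability_setC ?Sle//; exact: measurable_bool_fiber.
  by apply/seteqP; split => w /=; case: (S w <= t).
have mYS y b t : measurable [set w | Y w = y /\ (S w <= t) = b].
  by apply: measurableI; exact: measurable_bool_fiber.

(* Base rates and thresholds *)
set top := top_group mu in Halpha Hbeta.
have base_le : base (~~ top) <= base top.
  rewrite /top /top_group; case: ifP => //= /negbT.
  by rewrite -ltNge => /ltW.
have ba : beta <= alpha by rewrite Halpha Hbeta.
have := base01 top; rewrite -[base top]Halpha => /andP[a0 a1].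
have := base01 (~~ top); rewrite -[base _]Hbeta => /andP[b0 b1].
have t_top01 : 0 <= t_top <= 1.
  have [alpha0|alpha0] := eqVneq (2 * alpha) 0; first exact: Ht_top.2.
  have a2 : 0 < 2 * alpha by rewrite lt0r alpha0 mulr_ge0.
  rewrite (Ht_top.1 alpha0) divr_ge0 ?(ltW a2) ?addr_ge0//=.
  by rewrite ler_pdivrMr//; lra.
have t_bot01 : 0 <= t_bot <= 1.
  have [beta1|beta1] := eqVneq (2 * (1 - beta)) 0; first exact: Ht_bot.2.
  have b2 : 0 < 2 * (1 - beta) by rewrite lt0r beta1 mulr_ge0// subr_ge0.
  rewrite (Ht_bot.1 beta1) divr_ge0 ?(ltW b2) ?subr_ge0//=.
  by rewrite ler_pdivrMr//; lra.
(* If [alpha = 0], then [beta = 0] as well, and both sides vanish whatever value [t_top] has. *)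
have alpha_t : alpha * t_top = (alpha + beta) / 2.
  have [alpha0|alpha0] := eqVneq (2 * alpha) 0.
    have -> : alpha = 0 by lra.
    have -> : beta = 0 by lra.
    by rewrite mul0r addr0 mul0r.
  rewrite (Ht_top.1 alpha0); field.
  by apply: contraNneq alpha0 => ->; rewrite mulr0.
(* If [beta = 1], then [alpha = 1] too, and again both sides vanish. *)
have beta_t : (1 - beta) * t_bot = (alpha - beta) / 2.
  have [beta1|beta1] := eqVneq (2 * (1 - beta)) 0.
    have -> : beta = 1 by lra.
    have -> : alpha = 1 by lra.
    by rewrite subrr !mul0r.
  rewrite (Ht_bot.1 beta1); field.
  by apply: contraNneq beta1 => ->; rewrite mulr0.

(* Acceptance and error probabilities in each group *)
have mYt : measurable [set w | Yhat w = true] by exact: measurable_bool_fiber.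
have mYf : measurable [set w | Yhat w = false] by exact: measurable_bool_fiber.
have bot_top : (~~ top == top) = false by case: (top).
have Q_top : cond_prob P A top [set w | Yhat w = true] = ((alpha + beta) / 2)%:E.
  rewrite (@eq_measure_ae _ _ _ _ _
      [set w | Y w = true /\ (S w <= t_top) = true])//; last first.
    apply: filterS (aeY top) => w [Yw Aw] /=.
    by rewrite /Yhat /h_fair Aw eqxx Yw; split => /andP.
  by rewrite QYS QY Sle// -EFinM -[base _]Halpha alpha_t.
(* In this group the only errors are positives rejected by the randomization. *)
have Err_top : Err P A Y Yhat top = (alpha - beta) / 2.
  rewrite /Err (@eq_measure_ae _ _ _ _ _
      [set w | Y w = true /\ (S w <= t_top) = false])//; last first.
    apply: filterS (aeY top) => w [Yw Aw] /=.
    rewrite /Yhat /h_fair Aw eqxx Yw.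
    by case: (h _ _); case: (S w <= _) => /=; split => // -[].
  rewrite QYS QY Sgt// -EFinM -[base _]Halpha/= mulrBr mulr1 alpha_t.
  by field.
(* In the other group the only errors are negatives accepted by the randomization. *)
have Err_bot : Err P A Y Yhat (~~ top) = (alpha - beta) / 2.
  rewrite /Err (@eq_measure_ae _ _ _ _ _
      [set w | Y w = false /\ (S w <= t_bot) = true])//; last first.
    apply: filterS (aeY (~~ top)) => w [Yw Aw] /=.
    rewrite /Yhat /h_fair Aw bot_top Yw.
    by case: (h _ _); case: (S w <= _) => /=; split => // -[].
  by rewrite QYS QYF Sle// -EFinM -[base _]Hbeta.
have Q_bot :
    cond_prob P A (~~ top) [set w | Yhat w = true] = ((alpha + beta) / 2)%:E.
  (* Acceptance is a union here, whereas rejection is almost surely the single product event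
     [Y = false] and [S > t_bot]; hence the passage to the complement. *)
  rewrite (_ : [set w | _] = ~` [set w | Yhat w = false]); last first.
    by apply/seteqP; split => w /=; case: (Yhat w).
  rewrite probability_setC//.
  rewrite (@eq_measure_ae _ _ _ _ _
      [set w | Y w = false /\ (S w <= t_bot) = false])//; last first.
    apply: filterS (aeY (~~ top)) => w [Yw Aw] /=.
    rewrite /Yhat /h_fair Aw bot_top Yw.
    by case: (h _ _); case: (S w <= _) => /=; split => // -[].
  rewrite QYS QYF Sgt// -EFinM -[base _]Hbeta -EFinB mulrBr mulr1 beta_t.
  by congr (_%:E); field.

(* Demographic parity and the total error *)
split.
  apply: (independent_rv_bool (q := ((alpha + beta) / 2)%:E)) => // b.
  rewrite -cond_prob_mulE//; congr (_ * _)%E.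
  have : b = top \/ b = ~~ top by case: (b); case: (top); [left|right|right|left].
  by case=> ->.
have -> : Err P A Y Yhat false + Err P A Y Yhat true = alpha - beta.
  by move: Err_top Err_bot; case: (top) => /= -> ->; field.
have : `|alpha - beta| = alpha - beta by rewrite ger0_norm// subr_ge0.
(* [Delta_BR] is symmetric, so it does not matter which group has the larger base rate. *)
rewrite /Delta_BR Halpha Hbeta; case: (top) => //=.
by rewrite distrC.
Qed.
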